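(* The formal power series $D_I$ and $D_S$ in the variables $x_1,x_2,\dots$ satisfy $$D_I(x_1,x_2,\dots)=\frac{1+x_1-x_1x_2+x_1x_2\,D_I(x_1,\,x_2x_3,\,x_3x_4,\dots)}{1-x_1^2+x_1^2x_2^2-x_1^2x_2^2\,D_S(x_1^2,\,x_2^2x_3^2,\,x_3^2x_4^2,\dots)}.$$
   Context: For a permutation $\pi$ of length $n$, let $\sharp1(\pi)=n$, and for $k\geq2$ let $\sharp(12\text{-}3\text{-}\cdots\text{-}k)(\pi)$ be the number of index sets $i_1<i_2<\dots<i_k$ with $i_2=i_1+1$ and $\pi_{i_1}<\pi_{i_2}<\dots<\pi_{i_k}$ (for $k=2$ this is the number of rises). Let $\mathcal{S}(132)$ be the set of all permutations of all lengths (including the empty one) avoiding $132$ (no $i<j<k$ with $\pi_i<\pi_k<\pi_j$), and $\mathcal{I}(132)$ the subset of involutions ($\pi=\pi^{-1}$). Define $D_I(x_1,x_2,\dots)=\sum_{\pi\in\mathcal{I}(132)}x_1^{\sharp1(\pi)}\prod_{k\geq2}x_k^{\sharp(12\text{-}3\text{-}\cdots\text{-}k)(\pi)}$ and $D_S$ by the same sum over $\mathcal{S}(132)$. $D(y_1,y_2,\dots)$ denotes substitution $x_k\mapsto y_k$. (It is known that $D_S(x_1,x_2,\dots)=1/(1-x_1+x_1x_2-x_1x_2D_S(x_1,x_2x_3,x_3x_4,\dots))$.) *)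

(* Defs.v *)
From HB Require Import structures.
From mathcomp Require Import all_boot all_algebra all_fingroup.
From mathcomp Require Import finmap.
From mathcomp Require Import mathcomp_extra boolp classical_sets functions.
From mathcomp Require Import cardinality fsbigop.
From mathcomp Require Import monalg.

Set Implicit Arguments.
Unset Strict Implicit.
Unset Printing Implicit Defensive.

Import GRing.Theory.

Local Open Scope classical_set_scope.
Local Open Scope ring_scope.

Local Notation "1" := (@mone _) : monom_scope.
Local Notation "x * y" := (mmul x y) : monom_scope.

(* A formal power series in the variables indexed by [I] is an arbitrary family
   of coefficients indexed by the finitely supported monomials [{cmonom I}]:
   there is no bound on the degree or on the set of variables that occur. *)

Section Decompositions.
Variable I : choiceType.
Implicit Types (m a b : {cmonom I}) (p : {cmonom I} * {cmonom I}).

Definition decomp m : set ({cmonom I} * {cmonom I}) :=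
  [set p | mmul p.1 p.2 = m].

Lemma cmonom_decomp1 i m : m i != 0%N -> exists m', m = (ucm i * m')%M.
Proof.
move=> mi; exists (divcm m (ucm i)); apply/eqP/cmP => j.
rewrite cmM divcmE cmU; case: eqVneq => [<-|_]; last by rewrite add0n subn0.
by rewrite subnKC // lt0n.
Qed.

Lemma cmonom_mulI i : injective (fun m => (ucm i * m)%M).
Proof.
move=> m m' /eqP /cmP e; apply/eqP/cmP => j.
by have := e j; rewrite !cmM => /addnI.
Qed.

Lemma finite_decomp m : finite_set (decomp m).
Proof.
have [n] := ubnP (mdeg m); elim: n m => // n IHn m le_m.
have [/eqP m1|] := boolP (mdeg m == 0%N).
  apply: (@sub_finite_set _ _ [set (1%M, 1%M)]); last exact: finite_set1.
  move=> [a b] /= ab; have : (a * b)%M == 1%M by rewrite -mdeg_eq0 ab m1.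
  by rewrite cmM_eq1 => /andP[/eqP -> /eqP ->].
rewrite mdeg_eq0 => m1.
have [i mi] : exists i, m i != 0%N.
  apply: contrapT => H; move/negP: m1; apply; apply/cmP => i; rewrite cm1.
  by apply/eqP/negP => /negP mi; apply: H; exists i.
have [m' mE] := cmonom_decomp1 mi.
have lt_m' : (mdeg m' < n)%N by move: le_m; rewrite mE mdegM mdegU.
pose D := decomp m'.
have finD : finite_set D by apply: IHn.
apply: (@sub_finite_set _ _
  ((fun p => ((ucm i * p.1)%M, p.2)) @` D `|`
   (fun p => (p.1, (ucm i * p.2)%M)) @` D)); last first.
  by rewrite finite_setU; split; apply: finite_image.
move=> [a b] /= ab; have [ai|] := boolP (a i != 0%N).
  have [a' aE] := cmonom_decomp1 ai; left; exists (a', b); last by rewrite aE.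
  by apply: (@cmonom_mulI i); rewrite /= mulmA -aE ab.
rewrite negbK => /eqP ai; have bi : b i != 0%N.
  by move: mi; rewrite -ab cmM ai add0n.
have [b' bE] := cmonom_decomp1 bi; right; exists (a, b'); last by rewrite bE.
by apply: (@cmonom_mulI i); rewrite /= -mE -ab bE !mulmA (mulmC a).
Qed.

Definition divisors_of m : {fset {cmonom I}} :=
  ((fst @` fset_set (decomp m)) `|` (snd @` fset_set (decomp m)))%fset.

Lemma divisors_ofM a b :
  (a \in divisors_of (a * b)%M) && (b \in divisors_of (a * b)%M).
Proof.
have abD : (a, b) \in fset_set (decomp (a * b)%M).
  by rewrite in_fset_set ?inE //; apply: finite_decomp.
rewrite !in_fsetU; apply/andP; split; apply/orP; [left|right].
  exact: (in_imfset _ fst abD).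
exact: (in_imfset _ snd abD).
Qed.

End Decompositions.

Record fps (R : Type) (I : choiceType) :=
  Fps { fps_coef : {cmonom I} -> R }.

Coercion fps_coef : fps >-> Funclass.

Section FpsRing.
Variables (R : comNzRingType) (I : choiceType).
Local Notation M := {cmonom I}.
Local Notation S := (fps R I).
Implicit Types (f g h : S) (m a b : M).

Lemma fpsP f g : (forall m, f m = g m) -> f = g.
Proof. by case: f g => f [g] /= fg; congr Fps; apply: funext. Qed.

HB.instance Definition _ := gen_eqMixin S.
HB.instance Definition _ := gen_choiceMixin S.

Definition fps_zero : S := Fps (fun _ => 0).
Definition fps_opp f : S := Fps (fun m => - f m).
Definition fps_add f g : S := Fps (fun m => f m + g m).

Fact fps_addA : associative fps_add.
Proof. by move=> f g h; apply: fpsP => m /=; rewrite addrA. Qed.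
Fact fps_addC : commutative fps_add.
Proof. by move=> f g; apply: fpsP => m /=; rewrite addrC. Qed.
Fact fps_add0 : left_id fps_zero fps_add.
Proof. by move=> f; apply: fpsP => m /=; rewrite add0r. Qed.
Fact fps_addN : left_inverse fps_zero fps_opp fps_add.
Proof. by move=> f; apply: fpsP => m /=; rewrite addNr. Qed.

HB.instance Definition _ :=
  GRing.isZmodule.Build S fps_addA fps_addC fps_add0 fps_addN.

Definition fps_one : S := Fps (fun m => (m == 1%M)%:R).

Definition fps_mul f g : S :=
  Fps (fun m => \sum_(p \in decomp m) f p.1 * g p.2).

Lemma fps_mulE (D : {fset M}) f g m :
    (forall a b, (a * b)%M = m -> (a \in D) && (b \in D)) ->
  fps_mul f g m =
  \sum_(a <- D) \sum_(b <- D) if (a * b)%M == m then f a * g b else 0.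
Proof.
move=> Dm; rewrite /fps_mul /=.
pose r := [seq (a, b) | a <- (D : seq M), b <- (D : seq M)].
rewrite (@fsbigE _ _ _ _ _ [seq p <- r | mmul p.1 p.2 == m]); last first.
- move=> [a b] /= abm; rewrite mem_filter /= abm eqxx /= => /negP[].
  by have /andP[aD bD] := Dm _ _ abm; apply/allpairsP; exists (a, b).
- by move=> [a b] /=; rewrite mem_filter /= => /andP[/eqP].
- by apply: filter_uniq; apply: allpairs_uniq; rewrite ?fset_uniq// => -[? ?] [? ?] _ _ [-> ->].
rewrite big_filter_cond big_mkcond /=.
rewrite -(big_allpairs (F := fun p : M * M =>
  if mmul p.1 p.2 == m then f p.1 * g p.2 else 0)).
apply: eq_bigr => p _; congr (if _ then _ else _).
by apply/andP/eqP => [[/eqP]//|pm]; rewrite inE pm eqxx.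
Qed.

Lemma mem_divisors_of m a b : (a * b)%M = m ->
  (a \in divisors_of m) && (b \in divisors_of m).
Proof. by move=> <-; apply: divisors_ofM. Qed.

Fact fps_mulC : commutative fps_mul.
Proof.
move=> f g; apply: fpsP => m; rewrite !(fps_mulE _ _ (@mem_divisors_of m)).
rewrite exchange_big; apply: eq_bigr => a _; apply: eq_bigr => b _.
by rewrite mulmC mulrC.
Qed.

Fact fps_mul1 : left_id fps_one fps_mul.
Proof.
move=> f; apply: fpsP => m /=.
rewrite (fsbigD1 (1%M, m)) /=; [|exact: finite_decomp|by rewrite /decomp /= mul1m].
rewrite eqxx mul1r fsbig1 ?addr0 // => -[a b] /= [ab nab].
case: eqVneq => [a1|]; last by rewrite mul0r.
by case: nab; rewrite -ab a1 mul1m.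
Qed.

Fact fps_mulDl : left_distributive fps_mul fps_add.
Proof.
move=> f g h; apply: fpsP => m /=; rewrite -fsbig_split /=; last exact: finite_decomp.
by apply: eq_fsbigr => p _; rewrite mulrDl.
Qed.

Lemma fps_mul3E f g h m (D := divisors_of m) :
  fps_mul (fps_mul f g) h m =
  \sum_(a <- D) \sum_(b <- D) \sum_(c <- D)
    if (a * b * c)%M == m then f a * g b * h c else 0.
Proof.
rewrite (fps_mulE _ _ (@mem_divisors_of m)) -/D.
transitivity (\sum_(d <- D) \sum_(c <- D) \sum_(a <- D) \sum_(b <- D)
   if ((a * b)%M == d) && ((d * c)%M == m) then f a * g b * h c else 0).
  apply: eq_bigr => d _; apply: eq_bigr => c _.
  case: eqVneq => [dcm|_]; last first.
    by symmetry; apply: big1 => a _; apply: big1 => b _; rewrite andbF.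
  rewrite (@fps_mulE D _ _ d) => [|a b abd]; last first.
    have /andP[aD _] : (a \in D) && ((b * c)%M \in D).
      by apply: mem_divisors_of; rewrite mulmA abd.
    have /andP[bD _] : (b \in D) && ((a * c)%M \in D).
      by apply: mem_divisors_of; rewrite mulmA (mulmC b) abd.
    by rewrite aD bD.
  rewrite mulr_suml; apply: eq_bigr => a _.
  rewrite mulr_suml; apply: eq_bigr => b _.
  by rewrite andbT; case: ifP; rewrite ?mul0r.
rewrite exchange_big /=.
under eq_bigr do rewrite exchange_big /=.
rewrite exchange_big /=; apply: eq_bigr => a _.
under eq_bigr do rewrite exchange_big /=.
rewrite exchange_big /=; apply: eq_bigr => b _.
apply: eq_bigr => c _.
have [abD|abD] := boolP ((a * b)%M \in D).
  rewrite (big_fsetD1 _ abD) /= eqxx /= big_seq big1 ?addr0 // => d.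
  by rewrite in_fsetD1 eq_sym => /andP[/negPf ->].
rewrite big_seq big1 => [|d dD]; last first.
  by case: eqVneq => // abd; rewrite abd dD in abD.
by case: eqVneq => // /(@mem_divisors_of m) /andP[]; rewrite (negPf abD).
Qed.

Fact fps_mulA : associative fps_mul.
Proof.
move=> f g h; rewrite [LHS]fps_mulC; apply: fpsP => m.
rewrite !fps_mul3E [RHS]exchange_big; apply: eq_bigr => a _.
rewrite [RHS]exchange_big; apply: eq_bigr => b _; apply: eq_bigr => c _.
by rewrite -(mulmA c) (mulmC c) -(mulrA (f c)) (mulrC (f c)).
Qed.

Fact fps_one_neq0 : fps_one != 0.
Proof.
apply/eqP => /(congr1 (fun f : S => f 1%M)) /eqP /=.
by rewrite eqxx oner_eq0.
Qed.

HB.instance Definition _ := GRing.Zmodule_isComNzRing.Build S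
  fps_mulA fps_mulC fps_mul1 fps_mulDl fps_one_neq0.

Lemma fps_coefM f g m : (f * g) m = \sum_(p \in decomp m) f p.1 * g p.2.
Proof. by []. Qed.

Lemma fps_coef1 m : (1 : S) m = (m == 1%M)%:R.
Proof. by []. Qed.

Lemma fps_coef_sum (T : Type) (r : seq T) (P : pred T) (F : T -> S) m :
  (\sum_(i <- r | P i) F i) m = \sum_(i <- r | P i) F i m.
Proof. exact: (big_morph (fun f : S => f m)). Qed.

Definition fpsC (c : R) : S := Fps (fun m => if m == 1%M then c else 0).

Lemma fps_coefCM c f m : (fpsC c * f) m = c * f m.
Proof.
rewrite fps_coefM (fsbigD1 (1%M, m)) /=; last first.
- by rewrite /decomp /= mul1m.
- exact: finite_decomp.
rewrite eqxx fsbig1 ?addr0 // => -[a b] /= [ab nab].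
case: eqVneq => [a1|]; last by rewrite mul0r.
by case: nab; rewrite -ab a1 mul1m.
Qed.

Lemma fps_coefM1 f g : (f * g) 1%M = f 1%M * g 1%M.
Proof.
rewrite fps_coefM (_ : decomp 1%M = [set (1%M, 1%M)]) ?fsbig_set1 //.
apply/seteqP; split=> [[a b]|_ /= ->].
  by rewrite /decomp /= => /unitm[-> ->].
by rewrite /decomp /= mul1m.
Qed.

Lemma fps_coefX_lt h n m : h 1%M = 0 -> (mdeg m < n)%N -> (h ^+ n) m = 0.
Proof.
move=> h1; elim: n m => // n IHn m lt_mn; rewrite exprS fps_coefM fsbig1 //.
move=> [a b] /= ab; have [->|a1] := eqVneq a 1%M; first by rewrite h1 mul0r.
rewrite IHn ?mulr0 // -ltnS; apply: leq_trans lt_mn.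
by rewrite ltnS -ab mdegM -[ltnLHS]add0n ltn_add2r lt0n mdeg_eq0.
Qed.

(* The geometric series [1 + h + h ^+ 2 + ...], for [h] without constant
   term: only the powers up to [mdeg m] contribute to the coefficient at [m]. *)
Definition fps_geom h : S :=
  Fps (fun m => (\sum_(n < (mdeg m).+1) h ^+ n) m).

Lemma fps_geomE h m N : h 1%M = 0 -> (mdeg m <= N)%N ->
  fps_geom h m = (\sum_(n < N.+1) h ^+ n) m.
Proof.
move=> h1 le_mN; rewrite /= !fps_coef_sum.
rewrite -!(big_mkord xpredT (fun n => (h ^+ n) m)).
rewrite [RHS](@big_cat_nat _ _ _ (mdeg m).+1) //=.
rewrite [X in _ + X]big_nat_cond [X in _ + X]big1 ?addr0 // => n.
by rewrite andbT => /andP[lt_mn _]; apply: fps_coefX_lt.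
Qed.

Lemma fps_geomP h : h 1%M = 0 -> fps_geom h * (1 - h) = 1.
Proof.
move=> h1; apply: fpsP => m; pose G := \sum_(n < (mdeg m).+1) h ^+ n.
transitivity ((G * (1 - h)) m).
  rewrite !fps_coefM; apply: eq_fsbigr => -[a b]; rewrite inE => ab.
  by rewrite (@fps_geomE _ _ (mdeg m)) // -ab mdegM leq_addr.
have -> : G * (1 - h) = 1 - h ^+ (mdeg m).+1.
  by rewrite -{2}(expr1n S (mdeg m).+1) subrXX_comm; last exact: mulrC;
    rewrite mulrC; congr (_ * _); apply: eq_bigr => n _; rewrite expr1n mul1r.
have -> : (1 - h ^+ (mdeg m).+1) m = (1 : S) m - (h ^+ (mdeg m).+1) m by [].
by rewrite fps_coefX_lt ?subr0.
Qed.

End FpsRing.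

Section FpsUnit.
Variables (R : comUnitRingType) (I : choiceType).
Local Notation S := (fps R I).
Implicit Types f g : S.

Definition fps_unit : {pred S} := fun f => f 1%M \is a GRing.unit.

Definition fps_inv f : S :=
  if f \in fps_unit then
    fps_geom (1 - fpsC I (f 1%M)^-1 * f) * fpsC I (f 1%M)^-1
  else f.

Fact fps_mulVr : {in fps_unit, left_inverse 1 fps_inv *%R}.
Proof.
move=> f uf; rewrite /fps_inv uf -mulrA.
set h := 1 - _; have -> : fpsC I (f 1%M)^-1 * f = 1 - h by rewrite /h subKr.
apply: fps_geomP; rewrite /h.
have -> : (1 - fpsC I (f 1%M)^-1 * f) 1%M
        = (1 : S) 1%M - (fpsC I (f 1%M)^-1 * f) 1%M by [].
by rewrite fps_coef1 eqxx fps_coefCM mulVr ?subrr.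
Qed.

Fact fps_unitP f g : g * f = 1 -> f \in fps_unit.
Proof.
move=> /(congr1 (fun f : S => f 1%M)); rewrite fps_coefM1 fps_coef1 eqxx => gf.
by apply/unitrP; exists (g 1%M); split; rewrite // mulrC.
Qed.

Fact fps_inv_out : {in [predC fps_unit], fps_inv =1 id}.
Proof. by move=> f /negPf nf; rewrite /fps_inv nf. Qed.

HB.instance Definition _ := GRing.ComNzRing_hasMulInverse.Build S
  fps_mulVr fps_unitP fps_inv_out.

Lemma fps_unitE f : (f \is a GRing.unit) = (f 1%M \is a GRing.unit).
Proof. by []. Qed.

End FpsUnit.

Section FpsSubst.
Variable R : comNzRingType.

Definition fpsX (I : choiceType) (i : I) : fps R I :=
  Fps (fun m => (m == ucm i)%:R).

(* The sum of a family in which every monomial occurs in only finitely many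
   members.  Outside of this situation [\sum_(_ \in _)] is the junk value 0. *)
Definition fps_sum (I T : choiceType) (A : set T) (F : T -> fps R I) :
    fps R I :=
  Fps (fun m => \sum_(t \in A) F t m).

Definition fps_subst (I J : choiceType) (f : fps R I) (y : I -> fps R J) :
    fps R J :=
  fps_sum [set: {cmonom I}]
    (fun m => fpsC J (f m) * \prod_(i <- finsupp m) y i ^+ m i).

End FpsSubst.

Definition perms := {n : nat & 'S_n}.

Definition avoids132 (n : nat) (p : 'S_n) : bool :=
  ~~ [exists i : 'I_n, exists j : 'I_n, exists k : 'I_n,
        [&& (i < j)%N, (j < k)%N, (p i < p k)%N & (p k < p j)%N]].

Definition involution (n : nat) (p : 'S_n) : bool := p == (p^-1)%g.

Definition S132 : set perms := [set p | avoids132 (tagged p)].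
Definition I132 : set perms :=
  [set p | avoids132 (tagged p) /\ involution (tagged p)].

(* Occurrences of 12-3-...-k, for [2 <= k]: an index set is encoded by the
   increasing tuple of its elements. *)
Definition occ (k n : nat) (p : 'S_n) : nat :=
  #|[pred t : k.-tuple 'I_n |
      [&& sorted ltn [seq val i | i <- t],
          nth 0%N [seq val i | i <- t] 1 ==
            (nth 0%N [seq val i | i <- t] 0).+1
        & sorted ltn [seq val (p i) | i <- t]]]|.

(* The variables are x_1, x_2, ...: x_k is the variable of index [k.-1], and
   [x 0] is not used. *)
Definition x (k : nat) : fps int nat := fpsX int k.-1.

(* The product may stop at k = n since [occ k p = 0] for [n < k]. *)
Definition weight (p : perms) : fps int nat :=
  x 1 ^+ tag p * \prod_(2 <= k < (tag p).+1) x k ^+ occ k (tagged p).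

Definition DI : fps int nat := fps_sum I132 weight.
Definition DS : fps int nat := fps_sum S132 weight.

(* The substitution of [y k] for [x k], for all [1 <= k]. *)
Definition subst_x (f : fps int nat) (y : nat -> fps int nat) : fps int nat :=
  fps_subst f (fun i => y i.+1).

(* The lemmas below check that no junk value is involved: the sums behind [DI],
   [DS] and the substitutions x_1 := x_1^e, x_k := x_k^e x_(k+1)^e are finite in
   each coefficient, and the denominator of the theorem is invertible. *)

Section Monomials.
Variables (R : comNzRingType) (I : choiceType).
Implicit Types a b : {cmonom I}.

Definition fps_mon a : fps R I := Fps (fun m => (m == a)%:R).

Lemma fps_mon1 : fps_mon 1%M = 1.
Proof. by []. Qed.

Lemma fps_monM a b : fps_mon a * fps_mon b = fps_mon (a * b)%M.
Proof.
apply: fpsP => m; rewrite fps_coefM; have [->|mab] := eqVneq m (a * b)%M.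
  rewrite (fsbigD1 (a, b)) //=; last exact: finite_decomp.
  rewrite !eqxx mulr1 fsbig1 ?addr0 // => -[a' b'] /= [_ nab].
  case: (eqVneq a' a) => [a'a|]; last by rewrite mul0r.
  case: (eqVneq b' b) => [b'b|]; last by rewrite mulr0.
  by case: nab; rewrite a'a b'b.
rewrite /= (negPf mab) fsbig1 // => -[a' b'] /= ab.
case: (eqVneq a' a) => [a'a|]; last by rewrite mul0r.
case: (eqVneq b' b) => [b'b|]; last by rewrite mulr0.
by move/eqP: mab; rewrite -a'a -b'b; case.
Qed.

Lemma fps_monX a n : exists2 b, fps_mon a ^+ n = fps_mon b
                              & forall i, b i = (n * a i)%N.
Proof.
elim: n => [|n [b bE bi]]; first by exists 1%M => // i; rewrite cm1.
by exists (a * b)%M => [|i]; rewrite ?exprS ?bE ?fps_monM // cmM bi mulSn.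
Qed.

Lemma fps_mon_prod (T : Type) (r : seq T) (F : T -> fps R I)
    (e : T -> {cmonom I}) : (forall t, F t = fps_mon (e t)) ->
  exists2 b, \prod_(t <- r) F t = fps_mon b
           & forall i, b i = (\sum_(t <- r) e t i)%N.
Proof.
move=> Fe; elim: r => [|t r [b bE bi]].
  by exists 1%M => [|i]; rewrite big_nil // cm1.
exists (e t * b)%M => [|i]; last by rewrite big_cons cmM bi.
by rewrite big_cons bE Fe fps_monM.
Qed.

Lemma finite_fps_subst (f : fps R I) (y : I -> fps R I) n :
    (forall i, exists2 w, y i = fps_mon w & (0 < w i)%N) ->
  finite_set [set m : {cmonom I} |
    (fpsC I (f m) * \prod_(i <- finsupp m) y i ^+ m i) n != 0].
Proof.
move=> yw; apply: (@sub_finite_set _ _ (fst @` decomp n)); last first.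
  by apply: finite_image; apply: finite_decomp.
move=> m; rewrite /mkset => mn; suff le_mn i : (m i <= n i)%N.
  exists (m, divcm n m) => //=; apply/eqP/cmP => i.
  by rewrite cmM divcmE subnKC.
have /choice[w yE] : forall j, exists w : {cmonom I},
    y j ^+ m j = fps_mon w /\ (m j <= w j)%N.
  move=> j; have [w -> wj] := yw j; have [b -> bi] := fps_monX w (m j).
  by exists b; split; rewrite // bi leq_pmulr.
have [b bE bi] := fps_mon_prod (finsupp m) (fun j => (yE j).1).
move: mn; rewrite fps_coefCM bE /=; case: (eqVneq n b) => [-> _|_]; last first.
  by rewrite mulr0 eqxx.
have [mi|] := boolP (i \in finsupp m); last by rewrite memNfinsupp => /eqP->.
by rewrite bi (big_fsetD1 _ mi) /= (leq_trans (yE i).2) // leq_addr.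
Qed.

End Monomials.

Lemma xX_mon k n : exists2 b, x k ^+ n = fps_mon int b
                            & forall i, b i = (n * (k.-1 == i))%N.
Proof.
have -> : x k = fps_mon int (ucm k.-1) by [].
by have [b bE bi] := fps_monX int (ucm k.-1) n; exists b => // i; rewrite bi cmU.
Qed.

Lemma weight_mon (p : perms) :
  exists2 w, weight p = fps_mon int w & w 0%N = tag p.
Proof.
rewrite /weight big_nat_cond; case: (xX_mon 1 (tag p)) => a aE ai.
suff [b bE b0] : exists2 b, \prod_(2 <= k < (tag p).+1 | (2 <= k < (tag p).+1)%N && true)
    x k ^+ occ k (tagged p) = fps_mon int b & b 0%N = 0%N.
  exists (a * b)%M; last by rewrite cmM ai b0 muln1 addn0.
  by rewrite [X in X * _]aE bE fps_monM.
apply: (big_ind (fun f => exists2 b, f = fps_mon int b & b 0%N = 0%N)).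
- by exists 1%M; rewrite ?cm1.
- move=> f g [b fE b0] [c gE c0].
  by exists (b * c)%M; rewrite ?fE ?gE ?fps_monM // cmM b0 c0.
move=> k; rewrite andbT => /andP[k2 _].
have [b bE bi] := xX_mon k (occ k (tagged p)).
by exists b; rewrite // bi; case: k k2 {bE bi} => [|[|k]] // _; rewrite muln0.
Qed.

Lemma finite_weight m : finite_set [set p | weight p m != 0].
Proof.
apply: (@sub_finite_set _ _
  ((fun q : 'S_(m 0%N) => existT (fun n => 'S_n) _ q) @` [set: 'S_(m 0%N)])).
  move=> p; rewrite /mkset; have [w -> w0] := weight_mon p; rewrite /=.
  case: (eqVneq m w) => [->|]; last by rewrite eqxx.
  move=> _; case: p w0 => n q /= ->.
  by exists q.
by apply: finite_image; apply: finite_finset.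
Qed.

Lemma finite_subst (f : fps int nat) (e : nat) n : (0 < e)%N ->
  finite_set [set m : {cmonom nat} | (fpsC nat (f m) * \prod_(i <- finsupp m)
    (if i.+1 == 1%N then x 1 ^+ e else x i.+1 ^+ e * x i.+2 ^+ e) ^+ m i) n != 0].
Proof.
move=> e0; apply: finite_fps_subst => i.
have [a aE ai] := xX_mon i.+1 e.
have [b bE bi] := xX_mon i.+2 e.
case: eqVneq => [[i0]|_].
  by exists a; [rewrite -aE i0 | rewrite ai eqxx muln1].
exists (a * b)%M; first by rewrite [X in X * _]aE [X in _ * X]bE fps_monM.
by rewrite cmM ai eqxx muln1 addn_gt0 e0.
Qed.

Lemma denominator_unit (g : fps int nat) :
  1 - x 1 ^+ 2 + x 1 ^+ 2 * x 2 ^+ 2 - x 1 ^+ 2 * x 2 ^+ 2 * g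
    \is a GRing.unit.
Proof.
have factor (T : comNzRingType) (a b c : T) :
    1 - a ^+ 2 + a ^+ 2 * b - a ^+ 2 * b * c = 1 - a * (a * (1 - b + b * c)).
  rewrite [a * (a * _)]mulrA -expr2 mulrDr mulrBr mulr1 mulrA opprD opprB addrA.
  by congr (_ - _); rewrite addrCA addrC.
rewrite factor fps_unitE.
have coefB1 (f h : fps int nat) : (f - h) 1%M = f 1%M - h 1%M by [].
have x10 (h : fps int nat) : (x 1 * h) 1%M = 0.
  rewrite fps_coefM1 (_ : x 1 1%M = 0) ?mul0r //.
  by rewrite /x /= eq_sym cm1_eq1.
by rewrite coefB1 x10 subr0 fps_coef1 eqxx unitr1.
Qed.

(* Main.v *)
Require Import Defs.
From mathcomp Require Import all_boot all_algebra.
From mathcomp Require Import all_fingroup finmap zify ring.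
From mathcomp Require Import boolp classical_sets functions.
From mathcomp Require Import cardinality fsbigop monalg.

(* Write [p (-) q] for the skew sum and [p (+) 1] for [p] followed by a new
   maximum.  A nonempty 132-avoider is uniquely [(a (+) 1) (-) b] with [a] and
   [b] 132-avoiders.  Since inversion sends [p (-) q] to [q^-1 (-) p^-1] and
   commutes with [_ (+) 1], a nonempty 132-avoiding involution is either
   [a (+) 1] with [a] an involution, or
   [(a (+) 1) (-) c (-) (a^-1 (+) 1)] with [c] an involution and [a] arbitrary.
   The occurrences of 12-3-...-k in a skew sum lie in one of the summands, and
   those in [p (+) 1] either lie in [p] or extend an occurrence of
   12-3-...-(k-1) in [p] by the new maximum, which accounts for the
   substitution x_k := x_k x_(k+1).  By induction on the decomposition a
   132-avoider has as many occurrences as its inverse, so the two copies of [a]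
   contribute a square. *)

Set Implicit Arguments.
Unset Strict Implicit.
Unset Printing Implicit Defensive.

Import GRing.Theory.
Local Open Scope ring_scope.

(** * Decomposition of the permutations avoiding 132 *)

Section Permutations.
Local Open Scope nat_scope.
Implicit Types (p q a b c : perms) (i j k m n : nat).

(* The identity outside of [0, tag p): a permutation of all of [nat]. *)
Definition pfun p i : nat :=
  if insub i is Some j then val (tagged p j) else i.

Lemma pfunE p (i : 'I_(tag p)) : pfun p i = tagged p i.
Proof. by rewrite /pfun valK. Qed.

Lemma pfun_id p i : tag p <= i -> pfun p i = i.
Proof. by move=> le_pi; rewrite /pfun insubF // ltnNge le_pi. Qed.

Lemma pfun_lt p i : (pfun p i < tag p) = (i < tag p).
Proof.
case: (ltnP i (tag p)) => [lt_ip|le_pi]; last first.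
  by rewrite pfun_id // ltnNge le_pi.
by rewrite -[i]/(val (Ordinal lt_ip)) pfunE ltn_ord.
Qed.

Lemma permsP p q :
  tag p = tag q -> (forall i, i < tag p -> pfun p i = pfun q i) -> p = q.
Proof.
case: p q => n p [n' q] /= nn'; case: n' / nn' q => q e; congr existT.
apply/permP => i; apply: val_inj.
have := e i (ltn_ord i); rewrite (@pfunE (existT (fun m => 'S_m) n p)).
by rewrite (@pfunE (existT (fun m => 'S_m) n q)).
Qed.

Definition inv p : perms := existT (fun m => 'S_m) (tag p) (tagged p)^-1%g.

Lemma pfunK p : cancel (pfun p) (pfun (inv p)).
Proof.
move=> i; case: (ltnP i (tag p)) => [lt_ip|le_pi]; last by rewrite !pfun_id.
by rewrite -[i]/(val (Ordinal lt_ip)) pfunE (@pfunE (inv p)) /= permK.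
Qed.

Lemma pfun_inj p : injective (pfun p).
Proof. exact: can_inj (@pfunK p). Qed.

Lemma invK p : inv (inv p) = p.
Proof. by case: p => n p; rewrite /inv /= invgK. Qed.

Lemma pfunVK p : cancel (pfun (inv p)) (pfun p).
Proof. by move=> i; rewrite -{1}(invK p) pfunK. Qed.

Lemma inv_eq p q : tag q = tag p ->
  (forall i, i < tag p -> pfun q (pfun p i) = i) -> inv p = q.
Proof.
move=> e qp; apply: permsP => //= i lt_ip.
rewrite -{2}(pfunVK p i) qp //; by rewrite -(@pfun_lt (inv p)) in lt_ip.
Qed.

Lemma involutionP p : reflect (inv p = p) (involution (tagged p)).
Proof.
apply: (iffP eqP) => [e|]; first by case: p e => n p /= e; rewrite /inv /= -e.
move=> e; apply/permP => i; apply: val_inj.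
by have := congr1 (fun q => pfun q i) e; rewrite pfunE (@pfunE (inv p)).
Qed.

Lemma avoids132P p : reflect
  (forall i j k, i < j -> j < k -> k < tag p ->
     pfun p i < pfun p k -> pfun p k < pfun p j -> False)
  (avoids132 (tagged p)).
Proof.
apply: (iffP idP) => [/existsPn np i j k ij jk kp ik kj|np].
  have jp := ltn_trans jk kp; have ip := ltn_trans ij jp.
  move: (np (Ordinal ip)) => /existsPn /(_ (Ordinal jp)) /existsPn.
  move=> /(_ (Ordinal kp)) /=.
  rewrite -(pfunE (Ordinal ip)) -(pfunE (Ordinal jp)) -(pfunE (Ordinal kp)) /=.
  by rewrite ij jk ik kj.
apply/existsPn => i; apply/existsPn => j; apply/existsPn => k.
apply/negP => /and4P[ij jk]; rewrite -!pfunE => ik kj.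
exact: (np i j k).
Qed.

(* The identity if [f] does not restrict to a permutation of [0, n). *)
Definition perm_of n (f : nat -> nat) : perms :=
  existT (fun m => 'S_m) n
    (if @idP (injectiveb (fun i : 'I_n => insubd i (f i))) is ReflectT H
     then perm (injectiveP _ H) else 1%g).

Lemma pfun_perm_of n f i :
    (forall i, i < n -> f i < n) ->
    (forall i j, i < n -> j < n -> f i = f j -> i = j) ->
  i < n -> pfun (perm_of n f) i = f i.
Proof.
move=> fn finj ltin; rewrite -[i]/(val (Ordinal ltin)) pfunE /=.
(* The branch of [perm_of] that falls back to the identity contradicts the injectivity of [f] on
   [[0, n)]. *)
case: {-}_ / idP => [H|].
  by rewrite permE val_insubd /= fn.
case; apply/injectiveP => a b /(congr1 val); rewrite !val_insubd !fn //.
by move/finj => e; apply: val_inj; apply: e.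
Qed.

(** * Skew sums and appended maxima *)

Definition skew p q : perms := perm_of (tag p + tag q)
  (fun i => if i < tag p then pfun p i + tag q else pfun q (i - tag p)).

(** Since [pfun p] fixes [tag p], extending the domain by one position already appends the new
    maximum. *)
Definition snoc p : perms := perm_of (tag p).+1 (pfun p).

Lemma pfun_skew p q i : i < tag p + tag q -> pfun (skew p q) i =
  if i < tag p then pfun p i + tag q else pfun q (i - tag p).
Proof.
apply: pfun_perm_of => [{}i|{}i j].
  have := pfun_lt p i; have := pfun_lt q (i - tag p).
  case: (ltnP i (tag p)); lia.
have := pfun_lt q (i - tag p); have := pfun_lt q (j - tag p).
case: (ltnP i (tag p)) => ip; case: (ltnP j (tag p)) => jp; try lia.
  by move=> _ _ _ _ /addIn /pfun_inj.
move=> _ _ _ _ /pfun_inj; lia.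
Qed.

Lemma pfun_skewl p q i : i < tag p -> pfun (skew p q) i = pfun p i + tag q.
Proof. by move=> ip; rewrite pfun_skew ?ip // ltn_addr. Qed.

Lemma pfun_skewr p q i :
  i < tag q -> pfun (skew p q) (tag p + i) = pfun q i.
Proof. by move=> iq; rewrite pfun_skew ?ltn_add2l // ltnNge leq_addr addKn. Qed.

Lemma pfun_snoc p i : pfun (snoc p) i = pfun p i.
Proof.
case: (ltnP i (tag p).+1) => [ip|pi]; last first.
  by rewrite !pfun_id //; apply: ltnW.
apply: pfun_perm_of ip => [{}i|{}i j _ _ /pfun_inj //].
rewrite !ltnS leq_eqVlt => /predU1P[->|]; first by rewrite pfun_id.
by rewrite -pfun_lt => /ltnW.
Qed.

Lemma snoc_inj : injective snoc.
Proof.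
move=> p q e; apply: permsP => [|i _]; first by case: (congr1 (@tag _ _) e).
by rewrite -pfun_snoc e pfun_snoc.
Qed.

(** The position of the cut has to be given: by [skewA] one permutation may be a skew sum in several
    ways. *)
Lemma skew_inj p q a b : tag p = tag a -> skew p q = skew a b -> p = a /\ q = b.
Proof.
move=> epa e; have eqb : tag q = tag b.
  by have := congr1 (@tag _ _) e; rewrite /= epa => /addnI.
split; apply: permsP => // i ip.
  apply: (@addIn (tag q)); rewrite {2}eqb -pfun_skewl // e pfun_skewl //.
  by rewrite -epa.
by rewrite -(pfun_skewr p) // e epa pfun_skewr // -eqb.
Qed.

Lemma skewA p q a : skew p (skew q a) = skew (skew p q) a.
Proof.
apply: permsP => [|i] /=; first by rewrite addnA.
move=> lt_i; rewrite pfun_skew //=.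
rewrite [RHS]pfun_skew /= -?addnA //.
case: (ltnP i (tag p)) => ip.
  by rewrite ltn_addr // pfun_skewl //= (addnC (tag q)) -addnA (addnC (tag a)).
rewrite pfun_skew; last lia.
case: ltnP => iq; last by rewrite ltnNge subnDA ifN //; lia.
by rewrite ifT ?pfun_skew ?ifN //; lia.
Qed.

Lemma inv_skew p q : inv (skew p q) = skew (inv q) (inv p).
Proof.
apply: inv_eq => /= [|i]; first by rewrite addnC.
move=> lt_i; rewrite (pfun_skew lt_i); case: ltnP => ip.
  by rewrite addnC -[tag q]/(tag (inv q)) pfun_skewr ?pfunK // pfun_lt.
rewrite (@pfun_skewl (inv q)) /= ?pfunK; first by rewrite subnK.
by rewrite pfun_lt; lia.
Qed.

Lemma inv_snoc p : inv (snoc p) = snoc (inv p).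
Proof. by apply: inv_eq => // i _; rewrite !pfun_snoc pfunK. Qed.

(** By counting, the first [m] entries occupy exactly the [m] largest values, so the permutation can
    be cut at [m]. *)
Lemma skew_split p m : m <= tag p ->
    (forall i k, i < m -> m <= k < tag p -> pfun p k < pfun p i) ->
  exists a b, [/\ tag a = m, tag b = tag p - m & p = skew a b].
Proof.
move=> le_mp dec; set n := tag p - m.
(* [pfun p i] exceeds the [n] values at the positions from [m] on. *)
have pl i : i < m -> n <= pfun p i.
  move=> im; rewrite -(size_iota m n) -(size_map (pfun p)).
  rewrite -[leqRHS](size_iota 0).
  apply: uniq_leq_size.
    by rewrite map_inj_uniq ?iota_uniq //; apply: pfun_inj.
  move=> _ /mapP[k + ->]; rewrite !mem_iota => mk /=.
  by apply: dec => //; lia.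
have pr k : m <= k -> k < tag p -> pfun p k < n.
  move=> mk kp; have := kp; rewrite -pfun_lt => pkp.
  (* The [m] values at the positions before [m] lie strictly between [pfun p k] and [tag p]. *)
  suff : m <= tag p - (pfun p k).+1 by lia.
  rewrite -{1}(size_iota 0 m) -(size_map (pfun p)).
  rewrite -[leqRHS](size_iota (pfun p k).+1).
  apply: uniq_leq_size.
    by rewrite map_inj_uniq ?iota_uniq //; apply: pfun_inj.
  move=> _ /mapP[i + ->]; rewrite !mem_iota => im.
  have := dec i k; have := pfun_lt p i; lia.
have La i : i < m -> pfun (perm_of m (fun i => pfun p i - n)) i = pfun p i - n.
  apply: pfun_perm_of => [{}i im|{}i j im jm e].
    have := pl i im; have := pfun_lt p i; lia.
  by apply: (@pfun_inj p); have := pl i im; have := pl j jm; lia.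
have Lb i : i < n ->
    pfun (perm_of n (fun i => pfun p (m + i))) i = pfun p (m + i).
  apply: pfun_perm_of => [{}i im|{}i j _ _ /pfun_inj /addnI //].
  by apply: pr; lia.
exists (perm_of m (fun i => pfun p i - n)).
exists (perm_of n (fun i => pfun p (m + i))).
split=> //; apply: permsP => [|i ip] /=; first by rewrite subnKC.
rewrite pfun_skew /= ?subnKC //; case: ltnP => im.
  by rewrite La // subnK // pl.
by rewrite Lb ?subnKC //; lia.
Qed.

Lemma snoc_split p : 0 < tag p -> pfun p (tag p).-1 = (tag p).-1 ->
  exists2 a, p = snoc a & tag p = (tag a).+1.
Proof.
move=> p0 pmax; set n := (tag p).-1.
have Ln i : i < n -> pfun (perm_of n (pfun p)) i = pfun p i.
  apply: pfun_perm_of => [{}i ilt|{}i j _ _ /pfun_inj //].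
  have := pfun_lt p i; have : pfun p i <> pfun p n by move=> /pfun_inj; lia.
  rewrite pmax; lia.
exists (perm_of n (pfun p)) => //=; last by rewrite prednK.
apply: permsP => [|i ip] /=; first by rewrite prednK.
rewrite pfun_snoc; case: (ltnP i n) => [/Ln //|ni].
have -> : i = n by lia.
by rewrite [RHS]pfun_id.
Qed.

(** A 132 cannot meet both summands: its first entry is its smallest, whereas the left entries
    exceed the right ones. *)
Lemma avoids132_skew p q :
  avoids132 (tagged (skew p q)) = avoids132 (tagged p) && avoids132 (tagged q).
Proof.
apply/avoids132P/andP => [H|[/avoids132P Hp /avoids132P Hq] i j k ij jk kpq].
  split; apply/avoids132P => i j k ij jk kp ik kj.
    by apply: (H i j k) => //=; rewrite ?pfun_skewl; lia.
  apply: (H (tag p + i) (tag p + j) (tag p + k)) => //=;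
    rewrite ?pfun_skewr; lia.
rewrite /= in kpq; rewrite !pfun_skew; try lia.
case: (ltnP i (tag p)) => ip; case: (ltnP j (tag p)) => jp;
  case: (ltnP k (tag p)) => kp; try lia.
- by move=> *; apply: (Hp i j k) => //; lia.
- by have := pfun_lt q (k - tag p); lia.
- by have := pfun_lt q (k - tag p); lia.
- by move=> *; apply: (Hq (i - tag p) (j - tag p) (k - tag p)) => //; lia.
Qed.

(** The new position is last, so it could only carry the 2 of a 132, but its value is the
    maximum. *)
Lemma avoids132_snoc p :
  avoids132 (tagged (snoc p)) = avoids132 (tagged p).
Proof.
apply/avoids132P/avoids132P => H i j k ij jk kp /= ik kj.
  by apply: (H i j k) => //=; rewrite ?pfun_snoc //; lia.
move: ik kj; rewrite !pfun_snoc => ik kj; case: (ltnP k (tag p)) => kp'.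
  exact: (H i j k).
have ek : k = tag p by move: kp => /=; lia.
by move: kj; rewrite ek (@pfun_id p (tag p)) //; have := pfun_lt p j; lia.
Qed.

(** Let [j] be the position of the maximum. An entry before [j] that is smaller than an entry after
    [j] would form a 132 with it, so [p] can be cut just after [j]. *)
Lemma avoids132_split p : 0 < tag p -> avoids132 (tagged p) ->
  exists a b, p = skew (snoc a) b.
Proof.
move=> p0 /avoids132P Hp; set j := pfun (inv p) (tag p).-1.
have pj : pfun p j = (tag p).-1 by rewrite pfunVK.
have jp : j < tag p by rewrite -pfun_lt pj; lia.
have [i k im mk|a [b [ta tb pE]]] := @skew_split p j.+1 jp.
  have := pfun_lt p k; have : pfun p k <> pfun p j by move/pfun_inj; lia.
  have : pfun p i <> pfun p k by move/pfun_inj; lia.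
  case: (eqVneq i j) => [->|ij]; first lia.
  by have := Hp i j k; lia.
have [||c aE _] := @snoc_split a; first by rewrite ta.
- rewrite ta /=; apply: (@addIn (tag b)); rewrite -pfun_skewl ?ta //.
  by rewrite -pE pj tb; lia.
- by exists c, b; rewrite -aE.
Qed.

(** * Decomposition of the 132-avoiding involutions *)

Definition empty : perms := existT (fun m => 'S_m) 0 1%g.

Lemma tag0_empty p : tag p = 0 -> p = empty.
Proof. by move=> p0; apply: permsP => // i; rewrite p0. Qed.

Definition sandwich a c : perms := skew (snoc a) (skew c (snoc (inv a))).

Lemma inv_sandwich a c : inv (sandwich a c) = sandwich a (inv c).
Proof. by rewrite /sandwich !inv_skew !inv_snoc invK skewA. Qed.

Lemma pfun_sandwich a c : pfun (sandwich a c) (tag a) = (tag (sandwich a c)).-1.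
Proof. by rewrite pfun_skewl //= pfun_snoc pfun_id // addSn. Qed.

(** The position of the maximum is [tag a], which determines where to cut. *)
Lemma sandwich_inj a c a' c' :
  sandwich a c = sandwich a' c' -> a = a' /\ c = c'.
Proof.
move=> e; have ta : tag a = tag a'.
  by apply: (@pfun_inj (sandwich a c)); rewrite {2}e !pfun_sandwich e.
have [|/snoc_inj aE e'] := skew_inj _ e; first by rewrite /= ta.
split=> //; apply: (proj1 (skew_inj _ e')).
by have := congr1 (@tag _ _) e' => /=; lia.
Qed.

(** The maximum is at the last position of [snoc b], but not of a sandwich. *)
Lemma sandwich_neq_snoc a c b : sandwich a c <> snoc b.
Proof.
move=> e; have := pfun_sandwich a c; rewrite e /= pfun_snoc.
have te : tag b = (tag a + (tag c + (tag a).+1)) .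
  by have := congr1 (@tag _ _) e => /=; lia.
by rewrite -[RHS](pfun_id (leqnn (tag b))) => /pfun_inj; lia.
Qed.

(** The decomposition [(a (+) 1) (-) b] of [p] is compared with that of its inverse,
    [b^-1 (-) (a^-1 (+) 1)]. If [b] is nonempty, it is longer than [a], and the final block of the
    second form is cut off from [b]. *)
Lemma involution_split p : 0 < tag p ->
    avoids132 (tagged p) -> involution (tagged p) ->
  (exists2 a, p = snoc a & avoids132 (tagged a) /\ involution (tagged a)) \/
  (exists a c, [/\ p = sandwich a c, avoids132 (tagged a),
     avoids132 (tagged c) & involution (tagged c)]).
Proof.
move=> p0 avp /involutionP ip; have [a [b pE]] := avoids132_split p0 avp.
have [b0|b0] := posnP (tag b).
  left; have pE' : p = snoc a.
    rewrite pE; apply: permsP => [|i] /=; first by rewrite b0 addn0.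
    by rewrite b0 addn0 => ilt; rewrite pfun_skewl // b0 addn0.
  exists a => //; split; first by move: avp; rewrite pE' avoids132_snoc.
  by apply/involutionP; apply: snoc_inj; rewrite -inv_snoc -pE'.
right; have tp : tag p = (tag a).+1 + tag b by rewrite pE.
have pE2 : p = skew (inv b) (snoc (inv a)).
  by rewrite -{1}ip pE inv_skew inv_snoc.
(* The maximum is at position [tag a], so the last value, which belongs to [b],
   is [tag a]. *)
have ltab : tag a < tag b.
  have : pfun p (tag p).-1 = tag a.
    rewrite -[tag a](pfunK p) ip; congr (pfun p _).
    by rewrite pE pfun_skewl //= pfun_snoc pfun_id // addSn.
  have -> : (tag p).-1 = tag (snoc a) + (tag b).-1 by rewrite tp /=; lia.
  by rewrite pE pfun_skewr; [move=> <-; rewrite pfun_lt|]; lia.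
have [i k im /andP[mk kb]|c [d [tc td bE]]] :=
  @skew_split b (tag b - (tag a).+1) (leq_subr _ _).
  have pb j : j < tag b -> pfun b j = pfun p ((tag a).+1 + j).
    by move=> jb; rewrite pE -[(tag a).+1]/(tag (snoc a)) pfun_skewr.
  rewrite !pb //; last by lia.
  (* In the second form of [p], the position coming from [i] falls in [inv b], whose values are
     raised above those of [snoc (inv a)], where the one coming from [k] falls. *)
  rewrite pE2 pfun_skew /=; last lia.
  rewrite [X in _ < X]pfun_skew /=; last lia.
  rewrite ifN; last lia.
  rewrite ifT; last lia.
  have := pfun_lt (snoc (inv a)) ((tag a).+1 + k - tag b) => /=; lia.
have pE3 : p = skew (snoc a) (skew c d) by rewrite pE bE.
(* Both sides are now skew sums of three blocks with matching lengths, so [snoc a = inv d],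
   [c = inv c] and [d = snoc (inv a)]. *)
have := pE2; rewrite bE inv_skew -skewA pE3 => e.
have [|ad e'] := skew_inj _ e; first by rewrite /= td; lia.
have [|cc da] := skew_inj _ e'; first by [].
exists a, c; split.
- by rewrite /sandwich -da.
- by move: avp; rewrite pE avoids132_skew avoids132_snoc => /andP[].
- by move: avp; rewrite pE3 !avoids132_skew => /and3P[].
- by apply/involutionP; rewrite -cc.
Qed.

Lemma avoids132_ind (P : perms -> Prop) : P empty ->
    (forall a b, P a -> P b -> P (skew (snoc a) b)) ->
  forall p, avoids132 (tagged p) -> P p.
Proof.
move=> P0 PS p; have [n] := ubnP (tag p); elim: n p => // n IHn p pn avp.
have [/tag0_empty -> //|p0] := posnP (tag p).
have [a [b pE]] := avoids132_split p0 avp.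
move: avp pn; rewrite pE avoids132_skew avoids132_snoc /= => /andP[ava avb] pn.
by apply: PS; apply: IHn => //; lia.
Qed.

Lemma avoids132_inv p : avoids132 (tagged p) -> avoids132 (tagged (inv p)).
Proof.
elim/avoids132_ind: p / => [|a b ava avb]; last first.
  by rewrite inv_skew inv_snoc avoids132_skew avoids132_snoc avb.
by apply/avoids132P => i j k _ _; rewrite ltn0.
Qed.

Lemma sandwich_I132 a c : S132 a -> I132 c -> I132 (sandwich a c).
Proof.
move=> ava [avc /involutionP ic]; split.
  by rewrite !avoids132_skew !avoids132_snoc ava avc avoids132_inv.
by apply/involutionP; rewrite inv_sandwich ic.
Qed.

Lemma snoc_I132 a : I132 a -> I132 (snoc a).
Proof.
move=> [ava /involutionP ia]; split; first by rewrite avoids132_snoc.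
by apply/involutionP; rewrite inv_snoc ia.
Qed.

Lemma empty_I132 : I132 empty.
Proof.
split; first by apply/avoids132P => i j k _ _; rewrite ltn0.
by apply/involutionP; apply: tag0_empty.
Qed.

Lemma I132E : I132 = ([set empty] `|` (snoc @` I132 `|`
  (fun t => sandwich t.1 t.2) @` (S132 `*` I132)))%classic.
Proof.
apply/seteqP; split=> [p [avp ip]|p].
  have [/tag0_empty ->|p0] := posnP (tag p); first by left.
  right; have [[a -> [ava ia]]|[a [c [-> ava avc ic]]]] :=
    involution_split p0 avp ip.
    by left; exists a.
  by right; exists (a, c).
case=> [->|[[a Ia <-]|[[a c] [/= ? ?] <-]]].
- exact: empty_I132.
- exact: snoc_I132.
- exact: sandwich_I132.
Qed.
End Permutations.

(** * Occurrences *)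

Section Occ.
Local Open Scope nat_scope.
Implicit Types (p q : perms) (k m n : nat) (s : seq nat).

(* The occurrences as sequences of natural numbers, so that those of different
   permutations can be compared. *)
Definition occs k p : {fset seq nat} :=
  ((fun t : k.-tuple 'I_(tag p) => [seq val i | i <- t]) @`
    [pred t : k.-tuple 'I_(tag p) |
      [&& sorted ltn [seq val i | i <- t],
          nth 0%N [seq val i | i <- t] 1 ==
            (nth 0%N [seq val i | i <- t] 0).+1
        & sorted ltn [seq val (tagged p i) | i <- t]]])%fset.

Lemma card_occs k p : #|` occs k p| = occ k (tagged p).
Proof.
rewrite card_imfset /=; last by move=> t u /(inj_map val_inj) /val_inj.
by rewrite /occ cardE.
Qed.

Lemma occsE k p s : (s \in occs k p) = [&& size s == k, all (gtn (tag p)) s,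
  sorted ltn s, nth 0 s 1 == (nth 0 s 0).+1 & sorted ltn (map (pfun p) s)].
Proof.
apply/imfsetP/and5P => [[t /and3P[s1 s2 s3] ->]|[/eqP ss sp s1 s2 s3]].
  split=> //; first by rewrite size_map size_tuple.
    by apply/allP => _ /mapP[i _ ->]; apply: ltn_ord.
  by rewrite -map_comp (eq_map (@pfunE p)).
have [t tE] : exists t : k.-tuple 'I_(tag p), s = map val t.
  elim: s k ss sp {s1 s2 s3} => [|i s IHs] k <- /=; first by exists [tuple].
  move=> /andP[ip /(IHs _ erefl)[t tE]].
  by exists [tuple of Ordinal ip :: t] => /=; rewrite -tE.
exists t => //; apply/and3P; rewrite -tE; split=> //.
by move: s3; rewrite tE -map_comp (eq_map (@pfunE p)).
Qed.

Lemma occ_gt_tag k p : tag p < k -> occ k (tagged p) = 0.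
Proof.
move=> pk; rewrite -card_occs; apply/eqP; rewrite cardfs_eq0.
apply/eqP/fsetP => s.
rewrite in_fset0 occsE; apply/negP => /and5P[/eqP ss /allP sp s1 _ _].
move: pk; rewrite -ss ltnNge => /negP; apply.
rewrite -[leqRHS](size_iota 0); apply: uniq_leq_size.
  by apply: sorted_uniq s1; [exact: ltn_trans | exact: ltnn].
by move=> i /sp /=; rewrite mem_iota.
Qed.

Lemma sorted_map_addn m s : sorted ltn (map (addn m) s) = sorted ltn s.
Proof.
by rewrite sorted_map; apply: eq_sorted => i j /=; rewrite ltn_add2l.
Qed.

Lemma sorted_ltn_all_head i s : sorted ltn (i :: s) -> all (ltn i) s.
Proof. by move=> /= /(order_path_min ltn_trans). Qed.

(** Positions increase along an occurrence, so one that starts on the right stays there. Values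
    increase too, so one that starts on the left cannot drop to the smaller values on the right. *)
Lemma occs_skew k p q : 1 < k ->
  occs k (skew p q) = (occs k p `|` map (addn (tag p)) @` occs k q)%fset.
Proof.
move=> k1; apply/fsetP => s; rewrite in_fsetU occsE /=.
have left_map r : all (gtn (tag p)) r ->
    sorted ltn (map (pfun (skew p q)) r) = sorted ltn (map (pfun p) r).
  move=> /allP rp; rewrite -[RHS](sorted_map_addn (tag q)) -map_comp.
  congr (sorted _ _); apply/eq_in_map => i /rp /= ip.
  by rewrite pfun_skewl // addnC.
have right_map r : all (gtn (tag q)) r ->
    map (pfun (skew p q)) (map (addn (tag p)) r) = map (pfun q) r.
  move=> /allP rq; rewrite -map_comp; apply/eq_in_map => i /rq /= iq.
  by rewrite pfun_skewr.
apply/and5P/orP => [[/eqP ss sp s1 s2 s3]|[|/imfsetP[r /= + ->]]]; last 2 first.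
- rewrite occsE => /and5P[ss sp s1 s2 s3]; split=> //; last by rewrite left_map.
  by apply: sub_all sp => i /= ip; rewrite ltn_addr.
- rewrite occsE => /and5P[/eqP ss sp s1 s2 s3]; split.
  + by rewrite size_map ss.
  + by rewrite all_map; apply: sub_all sp => i /=; rewrite ltn_add2l.
  + by rewrite sorted_map_addn.
  (* As [1 < k], the indices 0 and 1 are within [r] and the default of [nth] is not read. *)
  + by rewrite !(nth_map 0) ?ss //; [rewrite (eqP s2) addnS | lia].
  + by rewrite right_map.
case: s ss sp s1 s2 s3 => [|i s]; first by move=> /= ks; move: k1; rewrite -ks.
move=> ss sp s1 s2 s3; case: (ltnP i (tag p)) => ip.
  have sp' : all (gtn (tag p)) (i :: s).
    apply/allP => j; rewrite inE => /predU1P[-> //|js]; rewrite /= ltnNge.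
    apply/negP => pj; have /allP/(_ j) := sp.
    rewrite inE js orbT => /(_ isT) /= jpq.
    have := sorted_ltn_all_head s3 => /allP/(_ (pfun (skew p q) j)).
    rewrite map_f // => /(_ isT) /=; rewrite pfun_skewl // pfun_skew //.
    rewrite ifN ?(ltnNge j) ?pj //.
    have := pfun_lt q (j - tag p); lia.
  by left; rewrite occsE ss eqxx sp' s1 s2 -left_map.
right; set t := i :: s in ss sp s1 s2 s3 *.
have tp j : j \in t -> tag p <= j.
  rewrite inE => /predU1P[-> //|js]; apply: leq_trans ip _; apply: ltnW.
  by have /allP := sorted_ltn_all_head s1; apply.
have [r tE] : exists r, t = map (addn (tag p)) r.
  exists (map (subn^~ (tag p)) t); rewrite -map_comp -[LHS]map_id.
  by apply/eq_in_map => j /tp /= ?; rewrite subnKC.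
apply/imfsetP; exists r => //; move: ss sp s1 s2 s3; rewrite tE.
rewrite size_map sorted_map_addn => ss sp s1 s2 s3.
have rq : all (gtn (tag q)) r.
  by move: sp; rewrite all_map; apply: sub_all => j /=; rewrite ltn_add2l.
rewrite /= occsE ss eqxx rq s1 -right_map // s3 andbT /=.
by move: s2; rewrite !(nth_map 0) ?ss //; [rewrite -addnS eqn_add2l | lia].
Qed.

Lemma occ_skew k p q : 1 < k ->
  occ k (tagged (skew p q)) = occ k (tagged p) + occ k (tagged q).
Proof.
move=> k1; rewrite -!card_occs occs_skew // cardfsU.
rewrite (card_imfset _ _ (inj_map (@addnI _))) /=.
(* The union is disjoint: the first index is below [tag p] on one side and at least [tag p] on the
   other. *)
rewrite (_ : (_ `&` _)%fset = fset0) ?cardfs0 ?subn0 //.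
apply/fsetP => s; rewrite in_fset0 in_fsetI.
apply/negP => /andP[+ /imfsetP[r /= + sE]].
rewrite !occsE sE => /and5P[/eqP ss sp _ _ _] _.
case: r sE ss sp => [|i r] _ /= ss; first by rewrite -ss in k1.
by move=> /andP[]; rewrite ltnNge leq_addr.
Qed.

(** Only the last index [z] can be the new position. Adjacency is stated on [rcons s z] because for
    [k = 1] it involves [z] itself, which is the case of rises. *)
Lemma occs_snoc k p s z : 0 < k ->
  (rcons s z \in occs k.+1 (snoc p)) = (rcons s z \in occs k.+1 p) ||
  [&& z == tag p, size s == k, all (gtn (tag p)) s, sorted ltn s,
      nth 0 (rcons s z) 1 == (nth 0 (rcons s z) 0).+1
    & sorted ltn (map (pfun p) s)].
Proof.
move=> k0; rewrite !occsE (eq_map (pfun_snoc p)) size_rcons eqSS.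
have [ss|_] /= := eqVneq (size s) k; last by rewrite !andbF.
have sortedE r y : sorted ltn (rcons r y) = all (gtn y) r && sorted ltn r.
  by rewrite !(sorted_pairwise ltn_trans) pairwise_rcons.
rewrite map_rcons !all_rcons /= ltnS leq_eqVlt !sortedE.
have sub r m : all (gtn m) r -> all (gtn m.+1) r.
  by apply: sub_all => j /= /ltnW.
have [->|zp] /= := eqVneq z (tag p).
  rewrite ltnn /= pfun_id // all_map.
  (* The values along [s] are below the new maximum exactly when its indices are below [tag p]. *)
  rewrite (@eq_all _ (preim _ _) _ (fun j => pfun_lt p j : _ = gtn (tag p) j)).
  by have [/[dup] /sub -> _|] := boolP (all (gtn (tag p)) s); rewrite ?andbF.
rewrite orbF -!andbA; apply: andb_id2l => zp'.
have [sz|] := boolP (all (gtn z) s); last by rewrite !andbF.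
have sp : all (gtn (tag p)) s.
  by apply: sub_all sz => j /= jz; apply: ltn_trans zp'.
by rewrite sp sub.
Qed.

Lemma occ_snoc k p : 1 < k ->
  occ k.+1 (tagged (snoc p)) = occ k.+1 (tagged p) + occ k (tagged p).
Proof.
move=> k1; rewrite -!card_occs.
have -> : occs k.+1 (snoc p) =
    (occs k.+1 p `|` (rcons^~ (tag p)) @` occs k p)%fset.
  apply/fsetP => s; rewrite in_fsetU; case/lastP: s => [|s z].
    rewrite !occsE /=; apply/esym/negP => /imfsetP[[|? ?] //].
  rewrite occs_snoc; last lia.
  congr (_ || _).
  apply/idP/imfsetP => [/and5P[/eqP -> ss sp s1 /andP[s2 s3]]|[r /= + e]].
    exists s => //=; rewrite occsE ss sp s1 s3 andbT /=.
    by move: s2; rewrite !nth_rcons (eqP ss) k1 ifT //; lia.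
  have [-> ->] := rcons_inj e.
  rewrite occsE => /and5P[ss -> -> r2 ->]; rewrite eqxx ss andbT /=.
  by move: r2; rewrite !nth_rcons (eqP ss) k1 ifT //; lia.
have rcons_tagI : injective (rcons^~ (tag p)) by move=> r t /rcons_inj[].
rewrite cardfsU (card_imfset _ _ rcons_tagI) /=.
rewrite (_ : (_ `&` _)%fset = fset0) ?cardfs0 ?subn0 //.
apply/fsetP => s; rewrite in_fset0 in_fsetI.
apply/negP => /andP[+ /imfsetP[r /= _ sE]].
by rewrite occsE sE all_rcons /= ltnn !andbF.
Qed.

(** The one possible new rise joins the last position of [p] to the new one, so it exists when [p]
    is nonempty. *)
Lemma occ2_snoc p :
  occ 2 (tagged (snoc p)) = occ 2 (tagged p) + (0 < tag p).
Proof.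
rewrite -!card_occs; case: (posnP (tag p)) => [p0|p0].
  rewrite addn0; congr #|` _ |; apply/fsetP => s; case/lastP: s => [|s z].
    by rewrite !occsE.
  rewrite occs_snoc // p0 (_ : [&& _, _ & _] = false) ?orbF //.
  by apply/negP => /and4P[_ + +]; case: s => //= i s; rewrite ltn0.
have -> : occs 2 (snoc p) = ([:: (tag p).-1; tag p] |` occs 2 p)%fset.
  apply/fsetP => s; rewrite in_fset1U; case/lastP: s => [|s z].
    by rewrite !occsE.
  rewrite occs_snoc // orbC; congr (_ || _).
  rewrite -[[:: _; _]]/(rcons [:: (tag p).-1] (tag p)) eqseq_rcons andbC.
  case: (eqVneq z) => [->|]; rewrite ?andbF //= andbT.
  case: s => [|i [|j s]] //=; last by rewrite !eqseq_cons andbF.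
  rewrite !andbT eqseq_cons andbT; lia.
rewrite cardfsU1 addnC occsE /= ltnn !andbF; lia.
Qed.

(** Inversion preserves the decomposition up to the order of the summands. The induction is for all
    [k] at once, since appending a maximum relates length [k.+1] to length [k]. *)
Lemma occ_inv k p : avoids132 (tagged p) -> 1 < k ->
  occ k (tagged (inv p)) = occ k (tagged p).
Proof.
move=> avp; elim/avoids132_ind: p / avp k => [|a b IHa IHb] k k1.
  by rewrite !occ_gt_tag //; apply: ltnW.
rewrite inv_skew inv_snoc !occ_skew // IHb // addnC; congr (_ + _).
case: k k1 => [|[|[|k]]] // _; first by rewrite !occ2_snoc IHa.
by rewrite !occ_snoc // !IHa.
Qed.
End Occ.

(** * Sums of summable families of power series *)

Section Series.
Variables (R : comNzRingType) (I : choiceType).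
Local Notation S := (fps R I).
Local Notation M := {cmonom I}.
Implicit Types (f g : S) (m u : M).

Lemma fps_coefD f g m : (f + g) m = f m + g m.
Proof. by []. Qed.

Definition summable (T : Type) (F : T -> S) :=
  forall m, finite_set [set t | F t m != 0]%classic.

Section Sums.
Variables (T : choiceType).
Implicit Types (A B : set T) (F G : T -> S) (r : seq T) (s : seq M).

(** The list may be larger than the support, so that several families or several coefficients can
    share one list. *)
Lemma fps_sumE A F r m : uniq r -> (forall t, F t m != 0 -> t \in r) ->
  fps_sum A F m = \sum_(t <- r | t \in A) F t m.
Proof.
move=> ur Fr; rewrite (bigfs _ ur) => [|t _ /negP tr]; last first.
  by apply/eqP/negP => /negP /Fr.
by congr (\sum_(t \in _) _); apply/seteqP; split=> t /=; rewrite inE.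
Qed.

(** A single list serves finitely many monomials; for products these are the divisors of a given
    monomial. *)
Lemma summable_seq F s : summable F ->
  exists2 r, uniq r & forall m t, m \in s -> F t m != 0 -> t \in r.
Proof.
move=> finF.
have : finite_set (\bigcup_(m in [set` s]) [set t | F t m != 0])%classic.
  by apply: bigcup_finite => [|m _]; [exact: finite_seq | exact: finF].
move=> /finite_fsetP[D DE]; exists (enum_fset D); first exact: fset_uniq.
move=> m t ms Ft; suff : [set` D]%classic t by [].
by rewrite -DE; exists m.
Qed.

Lemma fps_sum_image (U : choiceType) (h : U -> T) (A : set U) F :
  set_inj A h -> fps_sum (h @` A)%classic F = fps_sum A (F \o h).
Proof. by move=> hA; apply: fpsP => m; apply: fsbig_image. Qed.

Lemma fps_sumU A B F : summable F -> (A `&` B = set0)%classic ->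
  fps_sum (A `|` B)%classic F = fps_sum A F + fps_sum B F.
Proof.
move=> finF AB; apply: fpsP => m.
have [r ur /(_ m) Fr] := summable_seq [:: m] finF.
have {}Fr t : F t m != 0 -> t \in r by apply: Fr; rewrite inE.
rewrite fps_coefD !(fps_sumE _ ur Fr) !(big_mkcond (fun t => t \in _)).
rewrite -big_split; apply: eq_bigr => t _ /=; rewrite in_setU.
have [tA|_] := boolP (t \in A); last by rewrite add0r.
have [tB|_] := boolP (t \in B); last by rewrite addr0.
have tAB : (A `&` B)%classic t by split; apply: set_mem.
by rewrite AB in tAB.
Qed.

Lemma fps_sumD A F G : summable F -> summable G ->
  fps_sum A (fun t => F t + G t) = fps_sum A F + fps_sum A G.
Proof.
move=> finF finG; apply: fpsP => m.
have [r ur /(_ m) Fr] := summable_seq [:: m] finF.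
have [r' ur' /(_ m) Gr] := summable_seq [:: m] finG.
have uq := undup_uniq (r ++ r').
rewrite fps_coefD !(@fps_sumE _ _ _ _ uq) -?big_split //.
- by move=> t Gt; rewrite mem_undup mem_cat Gr ?orbT ?inE.
- by move=> t Ft; rewrite mem_undup mem_cat Fr ?inE.
move=> t; rewrite fps_coefD mem_undup mem_cat; apply: contraNT.
rewrite negb_or => /andP[tr tr'].
have -> : F t m = 0 by apply/eqP; apply: contraNT tr => /Fr -> //; rewrite inE.
have -> : G t m = 0 by apply/eqP; apply: contraNT tr' => /Gr -> //; rewrite inE.
by rewrite addr0.
Qed.

Lemma fps_sum_set1 t F : fps_sum [set t]%classic F = F t.
Proof. by apply: fpsP => m; apply: fsbig_set1. Qed.

(** This sums a correction carried by one index, such as the empty permutation in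
    [weight_at_snocE]. *)
Lemma fps_sum_delta A (t0 : T) (g : S) : A t0 ->
  fps_sum A (fun t => if t == t0 then g else 0) = g.
Proof.
move=> At0; apply: fpsP => m; rewrite (@fps_sumE _ _ [:: t0]) //.
  by rewrite big_cons big_nil mem_set // eqxx addr0.
by move=> t; rewrite inE; case: (t == t0) => //; rewrite eqxx.
Qed.

Lemma summable_delta (t0 : T) (g : S) :
  summable (fun t => if t == t0 then g else 0).
Proof.
move=> m; apply: (@sub_finite_set _ _ [set t0]%classic); last first.
  exact: finite_set1.
by move=> t /=; case: (eqVneq t) => //; rewrite eqxx.
Qed.

End Sums.

Lemma fps_coefM_neq0 f g m : (f * g) m != 0 ->
  exists a b, [/\ mmul a b = m, f a != 0 & g b != 0].
Proof.
move=> fg; apply: contrapT => H; move/negP: fg; apply; apply/eqP.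
rewrite fps_coefM fsbig1 // => -[a b] /= ab.
have [->|fa] := eqVneq (f a) 0; first by rewrite mul0r.
have [->|gb] := eqVneq (g b) 0; first by rewrite mulr0.
by case: H; exists a, b.
Qed.

(** Inside a product, an infinite sum can thus be replaced by a finite one that agrees with it on
    the divisors of [m]. *)
Lemma eq_fps_coefM f f' g g' m :
    {in divisors_of m, f =1 f'} -> {in divisors_of m, g =1 g'} ->
  (f * g) m = (f' * g') m.
Proof.
move=> ff gg; rewrite !fps_coefM; apply: eq_fsbigr => -[a b]; rewrite inE => ab.
by have /andP[/ff -> /gg ->] := mem_divisors_of ab.
Qed.

(** If [m] occurs in [F t * G t], one of its finitely many divisors occurs in [G t]. *)
Lemma summableM (T : choiceType) (F G : T -> S) :
  summable G -> summable (fun t => F t * G t).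
Proof.
move=> finG m; have [r _ Gr] := summable_seq (divisors_of m) finG.
apply: (@sub_finite_set _ _ [set` r]%classic); last exact: finite_seq.
move=> t /= /fps_coefM_neq0[a [b [/mem_divisors_of/andP[_ bm] _ Gb]]].
exact: Gr Gb.
Qed.

Lemma fps_sumZ (T : choiceType) (A : set T) g (F : T -> S) : summable F ->
  fps_sum A (fun t => g * F t) = g * fps_sum A F.
Proof.
move=> finF; apply: fpsP => m.
have [r ur Fr] := summable_seq (divisors_of m) finF.
rewrite (@eq_fps_coefM _ g _ (\sum_(t <- r | t \in A) F t)) // => [|u um].
  rewrite mulr_sumr fps_coef_sum; apply: fps_sumE => // t.
  by move=> /fps_coefM_neq0[a [b [/mem_divisors_of/andP[_ bm] _]]]; apply: Fr.
by rewrite fps_coef_sum; apply: fps_sumE => // t; apply: Fr.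
Qed.

(** For the coefficient at [m], both sums are truncated to lists covering all divisors of [m], and
    finite distributivity applies. *)
Lemma fps_sumM (T U : choiceType) (A : set T) (B : set U) F G :
    summable F -> summable G ->
  fps_sum A F * fps_sum B G =
  fps_sum (A `*` B)%classic (fun t : T * U => F t.1 * G t.2).
Proof.
move=> finF finG; apply: fpsP => m.
have [r ur Fr] := summable_seq (divisors_of m) finF.
have [s us Gs] := summable_seq (divisors_of m) finG.
rewrite (@eq_fps_coefM _ (\sum_(t <- r | t \in A) F t) _
  (\sum_(t <- s | t \in B) G t)) => [|u um|u um]; last 2 first.
- by rewrite fps_coef_sum; apply: fps_sumE => // t; apply: Fr.
- by rewrite fps_coef_sum; apply: fps_sumE => // t; apply: Gs.
rewrite (@fps_sumE _ _ _ [seq (t, v) | t <- r, v <- s]); last 2 first.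
- by apply: allpairs_uniq => // -[? ?] [? ?] _ _ [-> ->].
- move=> [t v] /= /fps_coefM_neq0[a [b [/mem_divisors_of/andP[am bm] Fa Gb]]].
  by apply/allpairsP; exists (t, v); split=> //=; [apply: Fr Fa | apply: Gs Gb].
rewrite [RHS]big_mkcond big_allpairs mulr_suml fps_coef_sum [LHS]big_mkcond.
apply: eq_bigr => t _; rewrite mulr_sumr fps_coef_sum [in LHS]big_mkcond.
have [tA|tA] := boolP (t \in A).
  apply: eq_bigr => v _; rewrite (_ : ((t, v) \in _) = (v \in B)) //.
  apply/idP/idP; rewrite !inE; first by case.
  by split=> //; apply: set_mem.
rewrite big1 // => v _; rewrite ifN //; apply: contra tA.
by rewrite !inE => -[].
Qed.

End Series.

(** * Substitution in sums of monomials *)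

Section Substitution.
Variables (R : comNzRingType) (I : choiceType).
Local Notation S := (fps R I).
Local Notation M := {cmonom I}.
Implicit Types (y : I -> S) (a b m n : M).

Definition monomial_at y m : S := \prod_(i <- finsupp m) y i ^+ m i.

Lemma monomial_at_sub y m (D : {fset I}) : (finsupp m `<=` D)%fset ->
  monomial_at y m = \prod_(i <- D) y i ^+ m i.
Proof.
move=> mD; apply: big_fset_incl => // i _.
by rewrite memNfinsupp => /eqP ->.
Qed.

Lemma monomial_atM y a b :
  monomial_at y (mmul a b) = monomial_at y a * monomial_at y b.
Proof.
rewrite (@monomial_at_sub y _ (finsupp a `|` finsupp b)%fset); last first.
  by rewrite mdomD.
rewrite (monomial_at_sub _ (fsubsetUl _ (finsupp b))).
rewrite (monomial_at_sub _ (fsubsetUr (finsupp a) _)).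
by rewrite -big_split /=; apply: eq_bigr => i _; rewrite cmM exprD.
Qed.

Lemma monomial_atU y i : monomial_at y (ucm i) = y i.
Proof. by rewrite /monomial_at mdomU big_seq_fset1 cmU eqxx. Qed.

Lemma monomial_at1 y : monomial_at y mone = 1.
Proof. by rewrite /monomial_at mdom1 big_seq_fset0. Qed.

Definition subst_mon y (f g : S) :=
  exists2 m, f = fps_mon R m & g = monomial_at y m.

Lemma subst_mon1 y : subst_mon y 1 1.
Proof. by exists mone; rewrite ?monomial_at1 ?fps_mon1. Qed.

Lemma subst_monM y f f' g g' :
  subst_mon y f g -> subst_mon y f' g' -> subst_mon y (f * f') (g * g').
Proof.
move=> [a -> ->] [b -> ->]; exists (mmul a b); first by rewrite fps_monM.
by rewrite monomial_atM.
Qed.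

Lemma subst_monX y f g (n : nat) :
  subst_mon y f g -> subst_mon y (f ^+ n) (g ^+ n).
Proof.
move=> fg; elim: n => [|n IHn]; first exact: subst_mon1.
by rewrite !exprS; apply: subst_monM.
Qed.

Variables (T : choiceType) (A : set T) (F G : T -> S) (y : I -> S).
Hypothesis FG : forall t, subst_mon y (F t) (G t).
Hypothesis finF : summable F.
Hypothesis y_pos : forall i, exists2 w, y i = fps_mon R w & (0 < w i)%N.

Let finite_monomial_at n : finite_set [set m | monomial_at y m n != 0]%classic.
Proof.
(* With all coefficients equal to 1, the terms of the substitution are the bare
   [monomial_at y m]. *)
have := finite_fps_subst (Fps (fun=> 1)) n y_pos.
by apply: sub_finite_set => m; rewrite /mkset fps_coefCM mul1r.
Qed.

(** A monomial [n] occurs in the images of finitely many monomials [m], each of which is [F t] for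
    finitely many [t]. *)
Lemma summable_subst : summable G.
Proof.
move=> n; have [s sE] := finite_fsetP.1 (finite_monomial_at n).
have [r _ Fr] := summable_seq s finF.
apply: (@sub_finite_set _ _ [set` r]%classic); last exact: finite_seq.
move=> t /=; have [m FE ->] := FG t => mn.
apply: (Fr m); last by rewrite FE /= eqxx oner_neq0.
suff : [set` s]%classic m by [].
by rewrite -sE.
Qed.

(** At each [n], finitely many monomials [m] and indices [t] contribute, so the two sums can be
    exchanged. For fixed [t], at most one [m] remains, since [F t] is a monomial. *)
Lemma fps_subst_sum : fps_subst (fps_sum A F) y = fps_sum A G.
Proof.
apply: fpsP => n; have [s sE] := finite_fsetP.1 (finite_monomial_at n).
have mem_s m : monomial_at y m n != 0 -> m \in s.
  by move=> mn; suff : [set` s]%classic m by []; rewrite -sE.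
have [r ur Fr] := summable_seq s finF.
rewrite [RHS](@fps_sumE _ _ _ _ _ r) // => [|t]; last first.
  have [m FE ->] := FG t => /mem_s ms.
  by apply: (Fr m) => //; rewrite FE /= eqxx oner_neq0.
rewrite [LHS](@fps_sumE _ _ _ _ _ s) ?fset_uniq // => [|m]; last first.
  rewrite fps_coefCM => mn; apply: mem_s; apply: contraNneq mn => ->.
  by rewrite mulr0.
transitivity (\sum_(m <- s) \sum_(t <- r | t \in A) F t m * monomial_at y m n).
  rewrite big_seq_cond [RHS]big_seq; apply: eq_big => [m|m /andP[ms _]].
    by rewrite in_setT andbT.
  rewrite fps_coefCM -mulr_suml; congr (_ * _).
  by apply: fps_sumE => // t; apply: Fr.
rewrite exchange_big; apply: eq_bigr => t _ /=.
have [m -> ->] := FG t; have [ms|ms] := boolP (m \in s).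
  rewrite (big_fsetD1 _ ms) /= eqxx mul1r big_seq big1 ?addr0 // => u.
  by rewrite in_fsetD1 => /andP[/negPf -> _]; rewrite mul0r.
rewrite big_seq big1 => [|u us].
  by apply/esym/eqP; apply: contraNT ms; apply: mem_s.
rewrite /=; case: eqVneq => [um|]; last by rewrite mul0r.
by rewrite -um us in ms.
Qed.

End Substitution.

(** * Generating functions *)

Section Weights.
Implicit Types (p q a c : perms) (y : nat -> fps int nat).

(** The case [y := x] is [weight]; other [y] give its images under substitution. *)
Definition weight_at y p : fps int nat :=
  y 1%N ^+ tag p * \prod_(2 <= k < (tag p).+1) y k ^+ occ k (tagged p).

Lemma weight_at_wide N y p : (tag p < N)%N -> weight_at y p =
  y 1%N ^+ tag p * \prod_(2 <= k < N) y k ^+ occ k (tagged p).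
Proof.
(* For length 0 the bound [(tag p).+1] is below 2, so the range cannot be cut there. *)
move=> pN; congr (_ * _); have [p0|p0] := posnP (tag p).
  rewrite big_geq ?p0 // big_nat big1 // => k /andP[k1 _].
  by rewrite occ_gt_tag ?p0 // (leq_trans _ k1).
rewrite [RHS](@big_cat_nat _ _ _ (tag p).+1) //= [X in _ * X]big_nat.
by rewrite [X in _ * X]big1 ?mulr1 // => k /andP[pk _]; rewrite occ_gt_tag.
Qed.

Lemma weight_at_empty y : weight_at y empty = 1.
Proof. by rewrite /weight_at big_geq // mulr1. Qed.

Lemma weight_at_skew y p q :
  weight_at y (skew p q) = weight_at y p * weight_at y q.
Proof.
have lt_pq : (tag p < (tag p + tag q).+1)%N by rewrite ltnS leq_addr.
have lt_qp : (tag q < (tag p + tag q).+1)%N by rewrite ltnS leq_addl.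
rewrite (weight_at_wide _ lt_pq) (weight_at_wide _ lt_qp) mulrACA -exprD.
rewrite -big_split /=; congr (_ * _); apply: eq_big_nat => k /andP[k1 _].
by rewrite occ_skew // exprD.
Qed.

Lemma weight_at_inv y p : avoids132 (tagged p) ->
  weight_at y (inv p) = weight_at y p.
Proof.
move=> avp; congr (_ * _); apply: eq_big_nat => k /andP[k1 _].
by rewrite occ_inv.
Qed.

Lemma weight_at_sqr y p :
  weight_at (fun k => y k ^+ 2) p = weight_at y p ^+ 2.
Proof.
rewrite /weight_at [RHS]exprMn -prodrXl exprAC; congr (_ * _).
by apply: eq_bigr => k _; rewrite exprAC.
Qed.

Definition shift y k := if k == 1%N then y 1%N else y k * y k.+1.

(** Each occurrence of length [k] in [p] remains and yields one of length [k.+1], hence a factor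
    [y k * y k.+1]. The new point gives [y 1], and the new rise, if any, gives [y 2]. *)
Lemma weight_at_snoc y p : weight_at y (snoc p) =
  y 1%N * y 2 ^+ (0 < tag p) * weight_at (shift y) p.
Proof.
have lt_p : (tag p < (tag p).+2)%N by [].
rewrite (@weight_at_wide (tag p).+3) // (weight_at_wide _ lt_p).
have -> : \prod_(2 <= k < (tag p).+2) shift y k ^+ occ k (tagged p) =
    \prod_(2 <= k < (tag p).+2) y k ^+ occ k (tagged p) *
    \prod_(2 <= k < (tag p).+2) y k.+1 ^+ occ k (tagged p).
  rewrite -big_split /=; apply: eq_big_nat => -[|[|k]] // _.
  by rewrite /shift /= exprMn.
have -> : \prod_(2 <= k < (tag p).+2) y k ^+ occ k (tagged p) =
    y 2 ^+ occ 2 (tagged p) *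
    \prod_(2 <= k < (tag p).+2) y k.+1 ^+ occ k.+1 (tagged p).
  (* The added factor, at [k = (tag p).+2], is 1; the range then has the right length for shifting
     the index. *)
  transitivity (\prod_(2 <= k < (tag p).+3) y k ^+ occ k (tagged p)).
    by rewrite [RHS]big_nat_recr //= occ_gt_tag // mulr1.
  by rewrite big_ltn // big_add1.
rewrite big_ltn // big_add1 /= occ2_snoc exprD /shift /=.
rewrite (eq_big_nat _ _ (F2 := fun k => y k.+1 ^+ occ k.+1 (tagged p) *
  y k.+1 ^+ occ k (tagged p))) => [|k /andP[k1 _]]; last first.
  by rewrite occ_snoc // exprD.
rewrite big_split /= exprS; ring.
Qed.

(** The dependence on whether [p] is empty becomes an additive correction, so that the identity can
    be summed over [p]. *)
Lemma weight_at_snocE y p : weight_at y (snoc p) =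
  y 1%N * y 2 * weight_at (shift y) p +
  if p == empty then y 1%N - y 1%N * y 2 else 0.
Proof.
rewrite weight_at_snoc; case: eqVneq => [->|p0].
  by rewrite weight_at_empty; ring.
have -> : (0 < tag p)%N.
  by rewrite lt0n; apply: contraNN p0 => /eqP/tag0_empty ->.
by rewrite addr0.
Qed.

Lemma weight_at_snoc_sqr y p : weight_at y (snoc p) ^+ 2 =
  y 1%N ^+ 2 * y 2 ^+ 2 * weight_at (fun k => shift y k ^+ 2) p +
  if p == empty then y 1%N ^+ 2 - y 1%N ^+ 2 * y 2 ^+ 2 else 0.
Proof.
rewrite weight_at_sqr weight_at_snocE; case: eqVneq => [->|_].
  by rewrite weight_at_empty; ring.
by rewrite !addr0; ring.
Qed.

Lemma weight_at_sandwich y a c : avoids132 (tagged a) ->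
  weight_at y (sandwich a c) = weight_at y (snoc a) ^+ 2 * weight_at y c.
Proof.
move=> ava; rewrite !weight_at_skew -inv_snoc weight_at_inv ?avoids132_snoc //.
by rewrite mulrCA mulrC expr2.
Qed.

Lemma summable_weight : summable weight.
Proof. exact: finite_weight. Qed.

Lemma summable_snoc : summable (weight \o snoc).
Proof.
move=> m; have := finite_weight m; apply: finite_preimage => p q _ _.
exact: snoc_inj.
Qed.

Lemma subst_mon_weight y p :
  subst_mon (fun i => y i.+1) (weight p) (weight_at y p).
Proof.
have xy k : (0 < k)%N -> subst_mon (fun i => y i.+1) (x k) (y k).
  by case: k => // k _; exists (ucm k); rewrite // monomial_atU.
apply: subst_monM; first by apply: subst_monX; apply: xy.
rewrite /weight_at !big_nat; elim/big_rec2: _ => [|k f g /andP[k1 _] fg].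
  exact: subst_mon1.
by apply: subst_monM => //; apply: subst_monX; apply: xy; apply: ltnW.
Qed.

(** * The substitution for [DI] ([e = 1]) and for [DS] ([e = 2]) *)

Section Substitutions.
Variable e : nat.
Hypothesis e_gt0 : (0 < e)%N.

Lemma shift_pos i :
  exists2 w, shift x i.+1 ^+ e = fps_mon int w & (0 < w i)%N.
Proof.
have [a aE ai] := xX_mon i.+1 e.
have [b bE bi] := xX_mon i.+2 e.
rewrite /shift; case: eqVneq => [[i0]|_].
  by exists a; [rewrite -aE i0 | rewrite ai eqxx muln1].
exists (mmul a b).
  by rewrite exprMn [X in X * _]aE [X in _ * X]bE fps_monM.
by rewrite cmM ai eqxx muln1 addn_gt0 e_gt0.
Qed.

Lemma summable_weight_at : summable (weight_at (fun k => shift x k ^+ e)).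
Proof.
apply: (@summable_subst _ _ _ weight _ _ _ summable_weight shift_pos).
exact: subst_mon_weight.
Qed.

Lemma subst_weight_sum A :
  subst_x (fps_sum A weight) (fun k => shift x k ^+ e) =
  fps_sum A (weight_at (fun k => shift x k ^+ e)).
Proof.
apply: (fps_subst_sum _ _ summable_weight shift_pos).
exact: subst_mon_weight.
Qed.

End Substitutions.

(** * Contributions of the families of involutions *)

Lemma snoc_sum : fps_sum (snoc @` I132)%classic weight =
  x 1 * x 2 * subst_x DI (shift x) + (x 1 - x 1 * x 2).
Proof.
have eqx : shift x = (fun k => shift x k ^+ 1).
  by apply: funext => k; rewrite expr1.
rewrite fps_sum_image; last by move=> p q _ _; apply: snoc_inj.
rewrite eqx subst_weight_sum // -eqx.
have finW := @summable_weight_at 1 isT; rewrite -eqx in finW.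
rewrite -(fps_sumZ _ _ finW) -[X in _ + X](fps_sum_delta _ empty_I132).
rewrite -fps_sumD.
- by congr fps_sum; apply: funext => p; apply: weight_at_snocE.
- exact: summableM.
- exact: summable_delta.
Qed.

Lemma snoc_sqr_sum : fps_sum S132 (fun p => weight (snoc p) ^+ 2) =
  x 1 ^+ 2 * x 2 ^+ 2 * subst_x DS (fun k => shift x k ^+ 2) +
  (x 1 ^+ 2 - x 1 ^+ 2 * x 2 ^+ 2).
Proof.
rewrite subst_weight_sum // -(fps_sumZ _ _ (summable_weight_at _)) //.
rewrite -[X in _ + X](fps_sum_delta _ (proj1 empty_I132 : S132 empty)).
rewrite -fps_sumD.
- by congr fps_sum; apply: funext => p; apply: weight_at_snoc_sqr.
- by apply: summableM; apply: summable_weight_at.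
- exact: summable_delta.
Qed.

Lemma sandwich_sum :
  fps_sum ((fun t => sandwich t.1 t.2) @` (S132 `*` I132))%classic weight =
  fps_sum S132 (fun p => weight (snoc p) ^+ 2) * DI.
Proof.
rewrite fps_sum_image; last first.
  by move=> [a c] [a' c'] _ _ /= /sandwich_inj[-> ->].
rewrite fps_sumM; last exact: summable_weight.
  apply: fpsP => m; apply: eq_fsbigr => -[a c]; rewrite inE => -[ava _].
  by congr (fps_coef _ m); apply: weight_at_sandwich.
rewrite (_ : (fun p => _) = fun p => weight (snoc p) * weight (snoc p)).
  exact: summableM summable_snoc.
by apply: funext => p; rewrite expr2.
Qed.

Lemma DI_split :
  DI = 1 + (x 1 * x 2 * subst_x DI (shift x) + (x 1 - x 1 * x 2)) +
    (x 1 ^+ 2 * x 2 ^+ 2 * subst_x DS (fun k => shift x k ^+ 2) +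
     (x 1 ^+ 2 - x 1 ^+ 2 * x 2 ^+ 2)) * DI.
Proof.
rewrite -snoc_sqr_sum -sandwich_sum -snoc_sum [LHS]/DI [in LHS]I132E.
rewrite (fps_sumU summable_weight); last first.
  (* The empty permutation is told apart from the other two families by its length. *)
  apply/seteqP; split=> // p [/= -> [[a _]|[[a c] _]]];
    by move/(congr1 (@tag _ _)) => /=; rewrite ?addSn.
rewrite (fps_sumU summable_weight); last first.
  by apply/seteqP; split=> // p [[b _ <-] [[a c] _ /sandwich_neq_snoc]].
by rewrite fps_sum_set1 addrA -[weight _]/(weight_at x _) weight_at_empty.
Qed.

End Weights.

Theorem theorem4p8 :
  DI = (1 + x 1 - x 1 * x 2
          + x 1 * x 2 *
            subst_x DI (fun k => if k == 1%N then x 1 else x k * x k.+1))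
       / (1 - x 1 ^+ 2 + x 1 ^+ 2 * x 2 ^+ 2
          - x 1 ^+ 2 * x 2 ^+ 2 *
            subst_x DS (fun k => if k == 1%N then x 1 ^+ 2
                                 else x k ^+ 2 * x k.+1 ^+ 2)).
Proof.
have -> : (fun k => if k == 1%N then x 1 ^+ 2 else x k ^+ 2 * x k.+1 ^+ 2) =
    (fun k => shift x k ^+ 2).
  by apply: funext => k; rewrite /shift; move: (x 1) (x k) (x k.+1) => u v w;
    case: ifP => _; rewrite ?exprMn.
apply: (canRL (mulrK (denominator_unit _))).
(* [DI_split] is linear in [DI]; it is solved over an arbitrary commutative ring, with the series as
   atoms for [ring]. *)
have solve (T : comNzRingType) (a b s t d : T) :
    d = 1 + (a * b * s + (a - a * b)) +
      (a ^+ 2 * b ^+ 2 * t + (a ^+ 2 - a ^+ 2 * b ^+ 2)) * d ->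
    d * (1 - a ^+ 2 + a ^+ 2 * b ^+ 2 - a ^+ 2 * b ^+ 2 * t) =
    1 + a - a * b + a * b * s.
  (* The left side is [d] minus the last summand of [e]; expanding only the first [d] then cancels
     that summand. *)
  move=> e; transitivity (d - (a ^+ 2 * b ^+ 2 * t +
    (a ^+ 2 - a ^+ 2 * b ^+ 2)) * d); first by ring.
  by rewrite {1}e; ring.
exact: solve DI_split.
Qed.
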